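(* Let $G$ be a finite solvable group that decomposes as a direct product $G = H_1\times H_2\times\cdots\times H_n$ with $\gcd(|H_i|,|H_j|)=1$ for all $i\neq j$. Then $$\mathcal{V}(G)=\frac{\sum_{i=1}^{n}s(H_i)}{\prod_{i=1}^{n}|L(H_i)|}.$$
   Context: For a finite group $G$, $L(G)$ denotes the set of all subgroups of $G$ (including the trivial subgroup and $G$ itself), $s(G)=\mathrm{Simp}(G)$ denotes the number of subgroups of $G$ that are simple groups (the trivial group is not simple; cyclic groups of prime order are simple), and $\mathcal{V}(G)=\dfrac{s(G)}{|L(G)|}$. Subgroups are counted as subsets of $G$, not up to isomorphism or conjugacy. *)

(* Defs.v *)
From mathcomp Require Import all_boot all_order all_algebra.
From mathcomp Require Import all_fingroup all_solvable.

Set Implicit Arguments.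
Unset Strict Implicit.
Unset Printing Implicit Defensive.

Import GRing.Theory.
Local Open Scope ring_scope.

(* [subgroups G] contains the trivial group and G, and the library's [simple]
   excludes the trivial group. *)
Definition Simp (gT : finGroupType) (G : {group gT}) : {set {group gT}} :=
  [set K in subgroups G | simple K].

Definition nb_subgroups (gT : finGroupType) (G : {group gT}) : nat :=
  #|subgroups G|.

Definition nb_simple (gT : finGroupType) (G : {group gT}) : nat := #|Simp G|.

Definition simple_ratio (gT : finGroupType) (G : {group gT}) : rat :=
  (nb_simple G)%:R / (nb_subgroups G)%:R.

(* Main.v *)
(** If [K \x H = G] with coprime orders, the constituents of any [x \in M] are
    powers of [x], so every subgroup [M] of [G] splits as
    [(M :&: K) * (M :&: H)]. Hence [L(G)] is in bijection with
    [L(K) x L(H)]. As both factors are normal in [M], a simple [M] lies in [K]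
    or in [H]. *)

Require Import Defs.
From mathcomp Require Import all_boot all_order all_algebra.
From mathcomp Require Import all_fingroup all_solvable.

Import GRing.Theory.
Local Open Scope ring_scope.

Section CoprimeDprod.

Variables (gT : finGroupType) (G K H : {group gT}).
Hypotheses (defG : (K \x H)%g = G) (coKH : coprime #|K| #|H|).

Local Open Scope group_scope.

Lemma coprime_dprod_setI_mul (M : {group gT}) :
  M \subset G -> (M :&: K) * (M :&: H) = M.
Proof.
move=> sMG; have [nsKG nsHG] := dprod_normal2 defG.
(* The index of [K] in [G] is [#|H|], coprime to [#|K|]; [H] is then Hall for the complementary
   primes, being a complement of [K]. *)
have hallK : \pi(K).-Hall(G) K.
  rewrite /pHall normal_sub //= pgroup_pi -divgS ?normal_sub //.
  by rewrite -(dprod_card defG) mulKn // -coprime_pi'.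
have hallH : \pi(K)^'.-Hall(G) H.
  have [_ mulKH _ tiKH] := dprodP defG.
  by rewrite -(compl_pHall _ hallK); apply/complP.
apply/eqP; rewrite eqEsubset mul_subG ?subsetIl //=.
(* A normal Hall subgroup contains every element of [G] whose order involves only its primes, so the
   two constituents of [x] fall in [K] and [H]. *)
apply/subsetP=> x Mx; rewrite -(consttC \pi(K) x).
by apply: mem_mulg; rewrite inE groupX //=
  ?(mem_normal_Hall hallK) ?(mem_normal_Hall hallH)
  ?p_elt_constt // groupX // (subsetP sMG).
Qed.

Lemma nb_subgroups_coprime_dprod :
  nb_subgroups G = (nb_subgroups K * nb_subgroups H)%N.
Proof.
have [_ mulKH cKH tiKH] := dprodP defG.
(* The join is a group for every pair; it equals the product [A * B] once [A] and [B] centralise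
   each other. *)
pose f (AB : {group gT} * {group gT}) := (AB.1 <*> AB.2)%G.
have fE (A B : {group gT}) : A \subset K -> B \subset H -> f (A, B) :=: A * B.
  by move=> sAK sBH; rewrite /= cent_joinEr // (centSS sBH sAK).
(* Modular law: [A * B :&: K = A * (B :&: K)], and [B :&: K] is trivial. This and its mirror image
   [fH] make [f] injective. *)
have fK (A B : {group gT}) : A \subset K -> B \subset H -> f (A, B) :&: K = A.
  move=> sAK sBH; have tiBK : B :&: K = 1.
    by apply/trivgP; rewrite /= setIC -tiKH setIS.
  by rewrite fE // -group_modl // tiBK mulg1.
have fH (A B : {group gT}) : A \subset K -> B \subset H -> f (A, B) :&: H = B.
  move=> sAK sBH; have tiHA : H :&: A = 1.
    by apply/trivgP; rewrite /= setIC -tiKH setSI.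
  by rewrite fE // setIC -group_modr // tiHA mul1g.
rewrite /nb_subgroups -cardsX.
rewrite -(card_in_imset (f := f) (D := finset.setX (subgroups K) (subgroups H))).
  apply: eq_card => M; rewrite inE; apply/idP/imsetP=> [sMG | [[A B]]].
    exists ((M :&: K)%G, (M :&: H)%G); first by rewrite !inE /= !subsetIr.
    by apply/group_inj; rewrite fE ?subsetIr // coprime_dprod_setI_mul.
  by rewrite !inE /= => /andP[sAK sBH] ->; rewrite fE // -mulKH mulgSS.
move=> [A B] [C D]; rewrite !inE /= => /andP[sAK sBH] /andP[sCK sDH] eqf.
congr pair; apply/group_inj.
  by rewrite -(fK A B) // eqf fK.
by rewrite -(fH A B) // eqf fH.
Qed.

Lemma nb_simple_coprime_dprod :
  nb_simple G = (nb_simple K + nb_simple H)%N.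
Proof.
have [nsKG nsHG] := dprod_normal2 defG.
have [_ _ _ tiKH] := dprodP defG.
rewrite /nb_simple; have -> : Simp G = Simp K :|: Simp H.
  apply/setP=> M; rewrite !inE; apply/andP/orP=> [[sMG simM] | ]; last first.
    by case=> /andP[sM simM]; split=> //;
      apply: subset_trans sM (normal_sub _).
  have [_ simMn] := simpleP _ simM.
  have [trK | MK] := simMn _ (normalGI sMG nsKG); [right | left].
    by rewrite simM andbT -(coprime_dprod_setI_mul _ sMG) trK mul1g subsetIr.
  by rewrite simM andbT; apply/setIidPl.
(* No simple group is counted twice: it would lie in [K :&: H = 1]. *)
rewrite cardsU disjoint_setI0 ?cards0 ?subn0 // disjoint_subset.
apply/subsetP=> M; rewrite !inE => /andP[sMK simM].
apply/negP=> /andP[sMH _]; have [/eqP[]] := simpleP _ simM.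
by apply/trivgP; rewrite -tiKH subsetI sMK.
Qed.

End CoprimeDprod.

(** Induction on [n], splitting off the first factor and applying the two-factor counts. For [n = 0]
    the group is trivial, with one subgroup and no simple one, matching the empty product and
    sum. *)
Lemma nb_subgroups_simple_coprime_bigdprod (gT : finGroupType) n
    (H : 'I_n -> {group gT}) (G : {group gT}) :
    (\big[dprod/1]_(i < n) (H i : {set gT}))%g = G ->
    (forall i j, i != j -> coprime #|H i| #|H j|) ->
  nb_subgroups G = (\prod_(i < n) nb_subgroups (H i))%N /\
  nb_simple G = (\sum_(i < n) nb_simple (H i))%N.
Proof.
elim: n H G => [|n IHn] H G.
  rewrite !big_ord0 => /esym G1 _; split.
    rewrite /nb_subgroups (_ : subgroups G = [set 1%G]) ?cards1 //.
    by apply/setP=> M; rewrite !inE G1 subG1.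
  apply/eqP; rewrite cards_eq0; apply/eqP/setP=> M; rewrite !inE G1 subG1.
  by apply/andP=> -[/eqP M1 /simpleP[/eqP[]]].
rewrite !big_ord_recl => defG coH.
(* As the direct product is defined, the product of the remaining factors is itself a group [L]. *)
have [[_ L _ defL] _ _ _] := dprodP defG; rewrite defL in defG.
have [|<- <-] := IHn (fun i => H (lift ord0 i)) L defL.
  by move=> i j neq_ij; apply: coH; rewrite (inj_eq lift_inj).
(* [#|L|] is the product of the remaining orders, each coprime to [#|H ord0|]. *)
have coH0L : coprime #|H ord0| #|L|.
  rewrite -(bigdprod_card defL).
  by elim/big_rec: _ => [|i k _ IHk]; rewrite ?coprimen1 // coprimeMr coH.
split; first exact: nb_subgroups_coprime_dprod defG coH0L.
exact: nb_simple_coprime_dprod defG coH0L.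
Qed.

Theorem proposition2p2 (gT : finGroupType) (G : {group gT}) (n : nat)
    (H : 'I_n -> {group gT})
    (solG : solvable G)
    (defG : (\big[dprod/1%g]_(i < n) (H i : {set gT}))%g = G)
    (coH : forall i j : 'I_n, i != j -> coprime #|H i| #|H j|) :
  simple_ratio G =
    (\sum_(i < n) (nb_simple (H i))%:R) / (\prod_(i < n) (nb_subgroups (H i))%:R).
Proof.
have [cardL cardS] := nb_subgroups_simple_coprime_bigdprod _ _ _ _ defG coH.
by rewrite /simple_ratio cardL cardS natr_sum natr_prod.
Qed.
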